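(* Let $\delta>0$ and let $\mu$ be a probability distribution on $\mathbb{R}$ defined by a density function $f$ that is decreasing for $x\ge 0$ and identically zero for $x<0$. Then for any integer $n\ge 1$, there is a shift-invariant $n$-sample estimator that is optimal.
   Context: For $\theta\in\mathbb{R}$, $\mu_\theta(A)=\mu(\{x:x+\theta\in A\})$, and $\mu_\theta^n$ is the product measure $\mu_\theta\times\cdots\times\mu_\theta$ on $\mathbb{R}^n$. An $n$-sample estimator is a (Borel) measurable function $e:\mathbb{R}^n\to\mathbb{R}$. Its ($\delta$-)quality is $Q(e)=\inf_{\theta\in\mathbb{R}}\mu_\theta^n(\{\mathbf{x}\in\mathbb{R}^n:|e(\mathbf{x})-\theta|<\delta\})$. It is shift-invariant if $e(x_1+c,\ldots,x_n+c)=e(x_1,\ldots,x_n)+c$ for all $c,x_i\in\mathbb{R}$. It is optimal (for the fixed $\delta$ and $n$) if $Q(e)\ge Q(e')$ for all $n$-sample estimators $e'$. *)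

(* Defs.v *)
From HB Require Import structures.
From mathcomp Require Import all_boot all_order all_algebra.
From mathcomp Require Import all_classical all_reals all_analysis.

Set Implicit Arguments.
Unset Strict Implicit.
Unset Printing Implicit Defensive.

Import Order.TTheory GRing.Theory Num.Theory.
Import numFieldNormedType.Exports.

Local Open Scope classical_set_scope.
Local Open Scope ring_scope.

Section product_power.
Context d (T : measurableType d) (R : realType).

Definition consT n (xt : T * n.-tuple T) : n.+1.-tuple T :=
  [tuple of xt.1 :: xt.2].

Lemma measurable_consT n : measurable_fun setT (@consT n).
Proof. exact: measurable_cons. Qed.

HB.instance Definition _ n :=
  isMeasurableFun.Build _ _ _ _ (@consT n) (@measurable_consT n).

(* The n-fold product P \x ... \x P on [n.-tuple T], whose sigma-algebra is the
   one generated by the coordinate maps (for T the Borel line, the Borel sets of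
   R^n). It is characterized by [product_power_box] below. *)
Fixpoint product_power (P : probability T R) n : probability (n.-tuple T) R :=
  if n is m.+1
  then distribution (P \x product_power P m)%E (@consT m)
  else \d_([tuple] : 0.-tuple T).

Lemma product_power_box (P : probability T R) n (A : 'I_n -> set T) :
  (forall i, measurable (A i)) ->
  product_power P n [set x | forall i, A i (tnth x i)] =
  (\prod_(i < n) P (A i))%E.
Proof.
elim: n A => [|n IH] A mA.
  by rewrite big_ord0 /= diracE mem_set//= => -[].
rewrite big_ord_recl -IH; last by move=> i; exact: mA.
set B := [set x | forall i, A (lift ord0 i) (tnth x i)].
have mB : measurable B.
  have -> : B = \bigcap_(i in [set: 'I_n])
      ((fun x => tnth x i) @^-1` A (lift ord0 i)).
    by apply/seteqP; split => x /= h i; [move=> _|]; exact: h.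
  apply: fin_bigcap_measurable => // i _.
  by rewrite -[X in measurable X]setTI; exact: measurable_tnth.
rewrite -product_measure1E//=; congr (_ _).
apply/seteqP; split => [[x t]/= h|[x t] /= [h0 h] i].
  split; first exact: (h ord0).
  by move=> i; have := h (lift ord0 i); rewrite tnthS.
case: (unliftP ord0 i) => [j|] ->; first by rewrite tnthS; exact: h.
by rewrite tnth0.
Qed.

End product_power.

Section estimation.
Context (R : realType).

(* R with its Borel sigma-algebra *)
Local Notation RB := (measurableTypeR R).

Definition translate (theta : R) (x : RB) : RB := (x : R) + theta.

Lemma measurable_translate theta : measurable_fun setT (translate theta).
Proof. by apply: (@measurable_realfun.measurable_funD _ _ R setT id (cst theta)). Qed.

HB.instance Definition _ theta :=
  isMeasurableFun.Build _ _ _ _ (translate theta) (measurable_translate theta).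

(* A |-> mu [set x | A (x + theta)] *)
Definition shifted (mu : probability RB R) (theta : R) : probability RB R :=
  distribution mu (translate theta).

Definition has_density (mu : probability RB R) (f : R -> R) : Prop :=
  [/\ measurable_fun [set: RB] (f : RB -> RB),
      forall x, 0 <= f x
    & forall A : set RB, measurable A ->
        mu A = (\int[lebesgue_measure]_(x in A) (f x)%:E)%E].

Definition estimator n := {mfun n.-tuple RB >-> RB}.

Definition quality (mu : probability RB R) (delta : R) n (e : estimator n)
    : \bar R :=
  ereal_inf (range (fun theta : R =>
    product_power (shifted mu theta) n
      [set x | `|(e x : R) - theta| < delta])).

Definition shift_invariant n (e : estimator n) : Prop :=
  forall (c : R) (x : n.-tuple RB),
    e (map_tuple (translate c) x) = translate c (e x).

Definition optimal (mu : probability RB R) (delta : R) n (e : estimator n)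
    : Prop :=
  forall e' : estimator n, (quality mu delta e' <= quality mu delta e)%E.

End estimation.

(* Main.v *)
From HB Require Import structures.
Require Import Defs.
From mathcomp Require Import all_boot all_order all_algebra.
From mathcomp Require Import all_classical all_reals all_analysis.
From mathcomp Require Import measurable_realfun.
From mathcomp Require Import ring lra.

Set Implicit Arguments.
Unset Strict Implicit.
Unset Printing Implicit Defensive.

Import Order.TTheory GRing.Theory Num.Theory.
Import numFieldNormedType.Exports.

Local Open Scope classical_set_scope.
Local Open Scope ring_scope.

(** The estimator that shifts the smallest observation down by [delta] is
    optimal.  Given a sample [x], the likelihood of [theta] is the product of
    the [f (x_i - theta)]; as [f] decreases on the half-line and vanishes to the
    left of it, this likelihood increases with [theta] up to the smallest
    observation and is zero beyond it.  Hence, among all intervals of length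
    [2 * delta], the one that ends at the smallest observation carries the
    largest likelihood, and its midpoint is [min x - delta].

    The quality is an infimum over [theta], not an integral, so this is turned
    into a proof of optimality by averaging [theta] over [[0, T[].  By Tonelli,
    the integral over [[0, T[] of the success probability of an estimator [e] is
    the integral over the samples [x] of the likelihood carried by the part of
    [[0, T[] at distance less than [delta] from [e x].  For each [x] that part
    can be exchanged ([interval_exchange]) for the interval that ends at
    [min x], or, if [min x] exceeds [T], for the interval [[T - 2 * delta, T[];
    the latter contributes at most [2 * delta] in total because probabilities
    are at most 1 ([average_success]).  The success probability of the shifted
    minimum does not depend on [theta] ([shift_invariant_quality]), so it equals
    its quality [p], and every estimator of quality [q] satisfies
    [T * q <= T * p + 2 * delta] for all [T > 0]; therefore [q <= p].

    The exchange of integrals needs the laws of the samples, for all [theta] at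
    once, to have densities with respect to one measure on the space of samples.
    The powers of the standard normal law serve as that measure: the normal
    density is positive everywhere, so every law with a density has one with
    respect to the normal law ([shifted_density]), and densities multiply under
    products ([product_power_density]). *)

(** * Integration against a density *)

Section density.
Local Open Scope ereal_scope.
Context d (T : measurableType d) (R : realType).
Variables (nu m : {measure set T -> \bar R}) (k : T -> R).
Hypothesis mk : measurable_fun setT k.
Hypothesis k0 : forall x, (0 <= k x)%R.
Hypothesis nuE : forall A, measurable A -> nu A = \int[m]_(x in A) (k x)%:E.

Import HBNNSimple.

Lemma density_indic A : measurable A ->
  nu A = \int[m]_x (\1_A x * k x)%:E.
Proof.
move=> mA; rewrite nuE// integral_mkcond.
by apply: eq_integral => x _; rewrite epatch_indic/= -EFinM mulrC.
Qed.

Let mkE D : measurable_fun D (fun x => (k x)%:E).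
Proof. exact/measurable_EFinP/measurable_funTS. Qed.

(** Both sides commute with increasing limits, so it is enough to compare them
    on simple functions, and by linearity on indicators. *)
Lemma ge0_integral_density (g : T -> \bar R) :
    measurable_fun setT g -> (forall x, 0 <= g x) ->
  \int[nu]_x g x = \int[m]_x (g x * (k x)%:E).
Proof.
move=> mg g0; pose h := nnsfun_approx measurableT mg.
have hg x : (EFin \o h n) x @[n --> \oo] --> g x by exact: cvg_nnsfun_approx.
transitivity (limn (fun n => \int[nu]_x (h n x)%:E)).
  rewrite -monotone_convergence//.
  - by apply: eq_integral => x _; apply/esym/cvg_lim => //; exact: hg.
  - by move=> n; exact/measurable_EFinP/measurable_funP.
  - by move=> n x _; rewrite lee_fin.
  - by move=> x _ a b ab; rewrite lee_fin; exact/lefP/nd_nnsfun_approx.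
transitivity (limn (fun n => \int[m]_x ((h n x)%:E * (k x)%:E))); last first.
  rewrite -monotone_convergence//.
  - apply: eq_integral => x _; apply/cvg_lim => //.
    by apply: cvgeZr => //; exact: hg.
  - move=> n; apply: emeasurable_funM => //.
    exact/measurable_EFinP/measurable_funP.
  - by move=> n x _; rewrite mule_ge0 ?lee_fin.
  - move=> x _ a b ab; rewrite lee_wpmul2r ?lee_fin//.
    exact/lefP/nd_nnsfun_approx.
congr (limn _); apply/funext => n.
under eq_integral do rewrite fimfunE -fsumEFin//.
rewrite ge0_integral_fsum//; last 2 first.
- by move=> r; exact/measurable_EFinP/measurable_funM.
- by move=> r x _; exact: nnfun_muleindic_ge0.
under [RHS]eq_integral => x _.
  rewrite fimfunE -fsumEFin// ge0_mule_fsuml; last first.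
    by move=> r; exact: nnfun_muleindic_ge0.
  over.
rewrite ge0_integral_fsum//; last 2 first.
- move=> r; apply: emeasurable_funM => //.
  exact/measurable_EFinP/measurable_funM.
- by move=> r x _; rewrite mule_ge0 ?lee_fin//; exact: nnfun_muleindic_ge0.
apply: eq_fsbigr => r; rewrite inE => -[x0 _ <-].
have mA : measurable (h n @^-1` [set h n x0]) by [].
under eq_integral do rewrite EFinM.
under [RHS]eq_integral do rewrite EFinM -muleA.
rewrite !ge0_integralZl_EFin//; first last.
- exact/measurable_EFinP.
- apply: emeasurable_funM => //; exact/measurable_EFinP.
- by move=> x _; rewrite mule_ge0 ?lee_fin.
by rewrite integral_indic// setIT density_indic.
Qed.

End density.

(** * Translation invariance of the Lebesgue measure *)

Section lebesgue_translation.
Context (R : realType).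
Local Notation RB := (measurableTypeR R).
Local Notation lambda := (@lebesgue_measure R).

Lemma lebesgue_measure_translate (c : R) (A : set RB) : measurable A ->
  pushforward lambda (translate c) A = lambda A.
Proof.
move=> mA; apply/esym/lebesgue_measure_unique => //= _ [[a b]] _ <-.
rewrite /pushforward/=.
have -> : translate c @^-1` `]a, b]%classic = `]a - c, b - c]%classic.
  by apply/seteqP; split => x /=; rewrite /translate !in_itv/= ltrBlDr lerBrDr.
rewrite !lebesgue_measure_itv/= !lte_fin ltrD2r.
by case: ifPn => // _; rewrite -!EFinB; congr EFin; ring.
Qed.

Lemma ge0_integral_translate (c : R) (g : RB -> \bar R) :
  measurable_fun setT g -> (forall x, (0 <= g x)%E) ->
  (\int[lambda]_x g x = \int[lambda]_x g (translate c x))%E.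
Proof.
move=> mg g0.
have := @ge0_integral_pushforward _ _ _ _ _ _ (measurable_translate c)
  lambda setT g measurableT mg (fun x _ => g0 x).
rewrite preimage_setT => <-.
by apply: eq_measure_integral => A mA _; exact/esym/lebesgue_measure_translate.
Qed.

End lebesgue_translation.

(** * Powers of a probability measure *)

Section product_power_lemmas.
Context d (T : measurableType d) (R : realType).

(** Conditioning on the first coordinate; the inductions on [n] below go through
    this identity. *)
Lemma product_powerS (P : probability T R) n (A : set (n.+1.-tuple T)) :
  product_power P n.+1 A =
  (\int[P]_x product_power P n [set t | A (consT (x, t))])%E.
Proof.
rewrite /= /distribution /pushforward /product_measure1.
apply: eq_integral => x _ /=; congr (product_power _ _ _).
by apply/seteqP; split => t /=; rewrite /xsection/= inE.
Qed.

Lemma measurable_consT_section n (A : set (n.+1.-tuple T)) x :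
  measurable A -> measurable [set t | A (consT (x, t))].
Proof.
move=> mA; rewrite -[X in measurable X]setTI.
by apply: (measurableT_comp (@measurable_consT _ T n)).
Qed.

Lemma measurable_fun_product_power_section (P : probability T R) n
    (A : set (n.+1.-tuple T)) : measurable A ->
  measurable_fun setT (fun x => product_power P n [set t | A (consT (x, t))]).
Proof.
move=> mA.
have mB : measurable (@consT _ T n @^-1` A).
  by rewrite -[X in measurable X]setTI; exact: measurable_consT.
have := measurable_fun_xsection (product_power P n) mB.
apply: eq_measurable_fun => x _ /=; congr (product_power _ _ _).
by apply/seteqP; split => t /=; rewrite /xsection/= inE.
Qed.

Lemma product_power_map (P : probability T R) (phi : {mfun T >-> T}) n
    (A : set (n.-tuple T)) : measurable A ->
  product_power (distribution P phi) n A =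
  product_power P n (map_tuple phi @^-1` A).
Proof.
elim: n A => [|n IH] A mA.
  by rewrite /= !diracE; congr (_%:R%:E); congr (nat_of_bool (_ \in _));
    apply/seteqP; split => x /=; rewrite (tuple0 x) (tuple0 (map_tuple _ _)).
rewrite !product_powerS ge0_integral_distribution//; last first.
  exact: measurable_fun_product_power_section.
apply: eq_integral => x _ /=; rewrite IH; last exact: measurable_consT_section.
congr (product_power _ _ _); apply/seteqP; split => t /=.
all: by congr A; apply/val_inj.
Qed.

(** The first factor [k x] comes from [ge0_integral_density] for [P] and [Q],
    the others from the induction hypothesis; Tonelli puts them under one
    integral. *)
Lemma product_power_density (P Q : probability T R) (k : T -> R) :
    measurable_fun setT k -> (forall x, 0 <= k x) ->
    (forall A, measurable A -> P A = (\int[Q]_(x in A) (k x)%:E)%E) ->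
  forall n (A : set (n.-tuple T)), measurable A ->
    product_power P n A =
    (\int[product_power Q n]_(x in A) (\prod_(i < n) k (tnth x i))%:E)%E.
Proof.
move=> mk k0 PE.
pose L n (x : n.-tuple T) := \prod_(i < n) k (tnth x i).
have mL n : measurable_fun setT (@L n).
  by apply: measurable_prod => i _; apply: measurableT_comp => //;
    exact: measurable_tnth.
have L0 n x : 0 <= @L n x by apply: prodr_ge0.
elim=> [|n IH] A mA.
  rewrite integral_mkcond integral_dirac//; last first.
    apply/(measurable_restrictT _ _).1 => //.
    by apply/measurable_EFinP; apply: measurable_funTS; exact: mL.
  rewrite diracT mul1e patchE; case: ifPn => Ax.
    by rewrite big_ord0 /= diracE Ax.
  by rewrite /= diracE (negbTE Ax).
rewrite -[RHS]/(\int[product_power Q n.+1]_(x in A) (@L n.+1 x)%:E)%E.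
pose h (z : T * n.-tuple T) : \bar R :=
  (\1_A (consT z) * (k z.1 * L n z.2))%:E.
have mh : measurable_fun setT h.
  apply/measurable_EFinP/measurable_funM.
    apply: measurableT_comp; last exact: measurable_consT.
    exact: measurable_indic.
  apply: measurable_funM.
    exact: (measurableT_comp mk measurable_fst).
  exact: (measurableT_comp (mL n) measurable_snd).
have h0 z : (0 <= h z)%E by rewrite lee_fin !mulr_ge0.
transitivity (\int[(Q \x product_power Q n)%E]_z h z)%E; last first.
  rewrite [RHS]integral_mkcond.
  have mAL : measurable_fun setT ((EFin \o @L n.+1) \_ A).
    apply/(measurable_restrictT _ _).1 => //.
    by apply/measurable_EFinP; apply: measurable_funTS; exact: mL.
  have AL0 x : (0 <= ((EFin \o @L n.+1) \_ A) x)%E.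
    by apply: erestrict_ge0 => y _; rewrite lee_fin.
  apply/esym; apply: eq_trans.
    exact: (@ge0_integral_distribution _ _ _ _ _
      (Q \x product_power Q n)%E (@consT _ T n) _ mAL AL0).
  apply: eq_integral => -[x t] _; rewrite epatch_indic /h /= -EFinM mulrC.
  congr (_ * _)%:E; rewrite /L big_ord_recl tnth0; congr *%R.
  by apply: eq_bigr => i _; rewrite tnthS.
rewrite fubini_tonelli1// product_powerS (ge0_integral_density mk k0 PE)//.
  apply: eq_integral => x _.
  rewrite IH; last exact: measurable_consT_section.
  rewrite muleC -ge0_integralZl_EFin//.
  - rewrite integral_mkcond; apply: eq_integral => t _.
    rewrite epatch_indic /h /= -!EFinM; congr EFin.
    by rewrite -[\1_[set _ | _] t]/(\1_A (consT (x, t))) mulrC.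
  - exact: measurable_consT_section.
  - by move=> t _; rewrite lee_fin; exact: L0.
  - by apply/measurable_EFinP; apply: measurable_funTS; exact: mL.
exact: measurable_fun_product_power_section.
Qed.

End product_power_lemmas.

(** * The smallest observation *)

Section sample_minimum.
Context (R : realType) (n : nat).
Local Notation RB := (measurableTypeR R).

(** An iterated minimum also takes its default value into account, so this has
    to be one of the observations. *)
Definition sample_min (x : n.+1.-tuple RB) : R :=
  \big[Num.min/(tnth x ord0 : R)]_(i < n.+1) (tnth x i : R).

Lemma sample_min_gtP (theta : R) (x : n.+1.-tuple RB) :
  reflect (forall i, theta < tnth x i) (theta < sample_min x).
Proof.
apply: (iffP (bigmin_gtP _ _ _ _)) => [[_ h] i|h]; first exact: h.
by split=> // i _; exact: h.
Qed.

Lemma measurable_sample_min : measurable_fun setT (sample_min : _ -> RB).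
Proof.
rewrite /sample_min; elim: (index_enum _) => [|i s IH].
  by under eq_fun do rewrite big_nil; exact: measurable_tnth.
under eq_fun do rewrite big_cons.
by apply: measurable_minr => //; exact: measurable_tnth.
Qed.

Lemma sample_min_translate (c : R) (x : n.+1.-tuple RB) :
  sample_min (map_tuple (translate c) x) = sample_min x + c.
Proof.
rewrite /sample_min tnth_map.
elim: (index_enum _) => [|i s IH]; first by rewrite !big_nil.
by rewrite !big_cons IH tnth_map /translate addr_minl.
Qed.

Definition min_estimator (delta : R) : n.+1.-tuple RB -> RB :=
  fun x => sample_min x - delta.

Lemma measurable_min_estimator (delta : R) :
  measurable_fun setT (min_estimator delta).
Proof.
by apply: measurable_funB; [exact: measurable_sample_min|exact: measurable_cst].
Qed.

HB.instance Definition _ (delta : R) := isMeasurableFun.Build _ _ _ _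
  (min_estimator delta) (measurable_min_estimator delta).

Lemma shift_invariant_min_estimator (delta : R) :
  shift_invariant (min_estimator delta : estimator R n.+1).
Proof.
by move=> c x; rewrite /= /min_estimator /translate sample_min_translate addrAC.
Qed.

End sample_minimum.

(** * Success probability of an estimator *)

Section shift_invariant_quality.
Context (R : realType) (mu : probability (measurableTypeR R) R) (delta : R).
Context (n : nat) (e : estimator R n).
Local Notation RB := (measurableTypeR R).

Lemma measurable_success_event :
  measurable [set z : RB * n.-tuple RB | `|(e z.2 : R) - z.1| < delta].
Proof.
have me : measurable_fun setT
    (fun z : RB * n.-tuple RB => `|(e z.2 : R) - z.1|).
  apply: (measurableT_comp (@normr_measurable R setT)).
  apply: measurable_funB; last by exact (@measurable_fst _ _ RB _).
  exact (measurableT_comp (@measurable_funP _ _ _ _ setT e) measurable_snd).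
have := @measurable_fun_ltr _ _ _ _ _ _ me (measurable_cst delta) measurableT
  [set true] I.
by rewrite setTI preimage_true.
Qed.

Lemma measurable_success (theta : R) :
  measurable [set x | `|(e x : R) - theta| < delta].
Proof.
rewrite -[X in measurable X]setTI.
exact: (pair1_measurable (theta : RB) measurableT measurable_success_event).
Qed.

(** Translating the sample by [theta] turns the event for 0 into the event for
    [theta]. *)
Lemma shift_invariant_quality : shift_invariant e -> forall theta,
  product_power (shifted mu theta) n [set x | `|(e x : R) - theta| < delta] =
  product_power mu n [set x | `|(e x : R)| < delta].
Proof.
move=> eI theta; rewrite product_power_map; last exact: measurable_success.
congr (product_power _ _ _); apply/seteqP.
by split => x /=; rewrite (eI theta x) /translate addrK.
Qed.

End shift_invariant_quality.

(** * Intervals carrying the largest likelihood *)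

Section interval_exchange.
Context (R : realType).
Local Notation RB := (measurableTypeR R).
Local Notation lambda := (@lebesgue_measure R).

(** Let [c] be the smaller of [m] and [T].  Up to points where [ell] vanishes,
    the set on the left lies below [c] and in [`]a - delta, a + delta[].  Move it
    to the right until that interval ends at [c], or leave it in place if the
    interval already reaches [c]: now it is inside [`]c - 2 * delta, c[], its
    length is the same, and [ell] did not decrease.  The two terms on the right
    cover the cases [c = m] and [c = T].  A move to the right that stays below
    [T] does not leave [[0, T[], so the truncation at 0 costs nothing. *)
Lemma interval_exchange (ell : RB -> R) (m T delta a : R) :
  measurable_fun setT ell -> (forall t, 0 <= ell t) ->
  (forall t, m <= t -> ell t = 0) ->
  (forall s t, s <= t -> t < m -> ell s <= ell t) ->
  (\int[lambda]_t
     (\1_`[0, T[ t * \1_[set u : R | `|a - u| < delta] t * ell t)%:E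
   <= \int[lambda]_t
     (\1_`[0, T[ t * \1_[set u : R | `|m - delta - u| < delta] t * ell t
      + \1_`[T - delta *+ 2, T[ t * ell t)%:E)%E.
Proof.
move=> mell ell0 ellm ellnd.
have mball b : measurable ([set u | `|b - u| < delta] : set RB).
  by have := @measurable_ball R b delta; rewrite -ball_normE.
have mitv (i : interval R) : measurable_fun setT (\1_[set` i] : RB -> R).
  have mi : measurable ([set` i] : set RB) by exact (measurable_itv i).
  exact: measurable_indic.
have mb b : measurable_fun setT (\1_[set u | `|b - u| < delta] : RB -> R).
  exact: measurable_indic.
set c := Num.min m T.
set s := Num.max 0 (c - (a + delta)).
have mL b : measurable_fun setT (fun t : RB =>
    \1_`[0, T[ t * \1_[set u : R | `|b - u| < delta] t * ell t).
  by apply: measurable_funM => //; apply: measurable_funM.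
(* [s] is the length of the move; after this the comparison is pointwise *)
rewrite (ge0_integral_translate (- s)); last 2 first.
- exact/measurable_EFinP.
- by move=> t; rewrite lee_fin !mulr_ge0.
apply: ge0_le_integral => //.
- by move=> t _; rewrite lee_fin !mulr_ge0.
- apply/measurable_EFinP; apply: (measurableT_comp (mL a)).
  exact: measurable_translate.
- apply/measurable_EFinP; apply: measurable_funD; first exact: mL.
  by apply: measurable_funM; first exact: mitv.
move=> t _; rewrite lee_fin /translate.
have nneg : 0 <= \1_`[0, T[ t * \1_[set u | `|m - delta - u| < delta] t
    * ell t + \1_`[T - delta *+ 2, T[ t * ell t.
  by rewrite addr_ge0// !mulr_ge0.
have [mt|tm] := leP m (t - s); first by rewrite [ell (t - s)]ellm// mulr0.
rewrite !indicE; case: (boolP (t - s \in _)) => [|_]; last by rewrite !mul0r.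
rewrite inE/= in_itv/= => /andP[ts0 tsT].
case: (boolP (t - s \in _)) => [|_]; last by rewrite mulr0 mul0r.
rewrite inE/= ltr_norml => /andP[ta ta'].
have s0 : 0 <= s by rewrite le_max lexx.
have sc : c - (a + delta) <= s by rewrite le_max lexx orbT.
have [cm cT] : c <= m /\ c <= T by split; rewrite ge_min lexx ?orbT.
have tc : t < c.
  have [h|h] := leP 0 (c - (a + delta)).
    have sE : s = c - (a + delta) by rewrite /s max_r.
    by lra.
  have sE : s = 0 by rewrite /s max_l// ltW.
  by rewrite lt_min; apply/andP; split; lra.
have ct : c - delta *+ 2 < t by lra.
rewrite !mul1r; apply: (@le_trans _ _ (ell t)); first by apply: ellnd; lra.
have -> : t \in `[0, T[%classic.
  by rewrite inE/= in_itv/=; apply/andP; split; lra.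
rewrite mul1r.
have [mT|Tm] := leP m T.
  have cE : c = m by rewrite /c min_l.
  rewrite [t \in [set u | _]]mem_set/=.
    by rewrite mul1r lerDl mulr_ge0.
  by rewrite ltr_norml; apply/andP; split; lra.
have cE : c = T by rewrite /c min_r// ltW.
rewrite [t \in `[T - _, T[%classic]mem_set/=.
  by rewrite mul1r lerDr mulr_ge0.
by rewrite in_itv/=; apply/andP; split; lra.
Qed.

End interval_exchange.

(** * The likelihood of the parameter *)

Section likelihood.
Context (R : realType) (mu : probability (measurableTypeR R) R) (g : R -> R).
Local Notation RB := (measurableTypeR R).
Local Notation lambda := (@lebesgue_measure R).
Hypothesis mg : measurable_fun [set: RB] (g : RB -> R).
Hypothesis g0 : forall x, 0 <= g x.
Hypothesis muE : forall A : set RB, measurable A ->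
  mu A = (\int[lambda]_(x in A) (g x)%:E)%E.

Local Notation rho := (@normal_prob R 0 1 : probability RB R).
Local Notation r := (@normal_pdf R 0 1).

Lemma normal_pdf_gt0 (x : R) : 0 < r x.
Proof.
rewrite /normal_pdf oner_eq0 mulr_gt0 ?expR_gt0// normal_peak_gt0//.
Qed.

(** Density at [x], with respect to the standard normal law, of the law shifted
    by [theta]. *)
Definition likelihood1 (theta x : R) : R := g (x - theta) / r x.

Lemma likelihood1_ge0 theta x : 0 <= likelihood1 theta x.
Proof. by rewrite divr_ge0// ltW// normal_pdf_gt0. Qed.

Lemma measurable_likelihood1 d (T : measurableType d) (u v : T -> RB) :
  measurable_fun setT u -> measurable_fun setT v ->
  measurable_fun setT (fun t => likelihood1 (u t) (v t)).
Proof.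
move=> hu hv; apply: measurable_funM.
  apply: (measurableT_comp mg).
  by apply: (@measurable_funB _ _ R).
apply: (@measurableT_comp _ _ _ _ RB _ (fun x => (r x)^-1)) hv.
apply: continuous_measurable_fun => x.
by apply: cvgV; [rewrite gt_eqF// normal_pdf_gt0|exact: continuous_normal_pdf].
Qed.

Lemma shifted_density theta (A : set RB) : measurable A ->
  shifted mu theta A = (\int[rho]_(x in A) (likelihood1 theta x)%:E)%E.
Proof.
move=> mA.
have mAi : measurable_fun setT (\1_A : RB -> R) by exact: measurable_indic.
have ml : measurable_fun setT (likelihood1 theta : RB -> R).
  by apply: measurable_likelihood1.
rewrite -[LHS]/(mu (translate theta @^-1` A)) (density_indic muE); last first.
  by rewrite -[X in measurable X]setTI; exact: measurable_translate.
have mAg : measurable_fun setT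
    (fun x : RB => (\1_A x * g (x - theta))%:E : \bar R).
  apply/measurable_EFinP/measurable_funM => //.
  apply: (measurableT_comp mg); exact: (measurable_translate (- theta)).
transitivity (\int[lambda]_x (\1_A x * g (x - theta))%:E)%E.
  rewrite (ge0_integral_translate theta)//; last first.
    by move=> x; rewrite lee_fin mulr_ge0.
  by apply: eq_integral => x _; rewrite {2}/translate addrK.
rewrite [RHS]integral_mkcond.
rewrite (@ge0_integral_density _ _ _ rho lambda r)//.
- apply: eq_integral => x _; rewrite epatch_indic/= -!EFinM /likelihood1 mulrAC.
  by rewrite divfK ?gt_eqF ?normal_pdf_gt0// mulrC.
- exact: measurable_normal_pdf.
- by move=> x; rewrite ltW// normal_pdf_gt0.
- apply/(measurable_restrictT _ _).1 => //.
  by apply/measurable_EFinP; apply: measurable_funTS; exact: ml.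
- by apply: erestrict_ge0 => x _; rewrite lee_fin likelihood1_ge0.
Qed.

Definition likelihood n (theta : R) (x : n.-tuple RB) : R :=
  \prod_(i < n) likelihood1 theta (tnth x i).

Lemma likelihood_ge0 n theta (x : n.-tuple RB) : 0 <= likelihood theta x.
Proof. by apply: prodr_ge0 => i _; exact: likelihood1_ge0. Qed.

Lemma measurable_likelihood n :
  measurable_fun setT (fun z : RB * n.-tuple RB => likelihood z.1 z.2).
Proof.
apply: measurable_prod => i _; apply: measurable_likelihood1 => //.
exact: (measurableT_comp (measurable_tnth i) measurable_snd).
Qed.

Lemma product_shifted_density n theta (A : set (n.-tuple RB)) : measurable A ->
  product_power (shifted mu theta) n A =
  (\int[product_power rho n]_x (\1_A x * likelihood theta x)%:E)%E.
Proof.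
move=> mA.
rewrite (@product_power_density _ _ _ _ rho (likelihood1 theta))//.
- rewrite integral_mkcond; apply: eq_integral => x _.
  by rewrite epatch_indic/= -EFinM mulrC.
- exact: measurable_likelihood1.
- exact: likelihood1_ge0.
- exact: shifted_density.
Qed.

(** The value 0 at 0 makes the likelihood vanish when [theta] is the smallest
    observation, a parameter that the open interval of radius [delta] around
    [min x - delta] does not contain. *)
Hypothesis g_neg : forall x, x <= 0 -> g x = 0.
Hypothesis g_decr : forall x y, 0 < x -> x <= y -> g y <= g x.

Lemma likelihood_after_min n theta (x : n.+1.-tuple RB) :
  sample_min x <= theta -> likelihood theta x = 0.
Proof.
rewrite leNgt => /sample_min_gtP/existsNP[i /negP]; rewrite -leNgt => xi.
apply/eqP; rewrite prodf_seq_eq0; apply/hasP; exists i.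
  by rewrite mem_index_enum.
by rewrite /= /likelihood1 g_neg ?mul0r// subr_le0.
Qed.

Lemma likelihood_nondecreasing n s t (x : n.+1.-tuple RB) :
  s <= t -> t < sample_min x -> likelihood s x <= likelihood t x.
Proof.
move=> st /sample_min_gtP tx; apply: ler_prod => i _.
rewrite likelihood1_ge0/= ler_wpM2r ?invr_ge0 ?(ltW (normal_pdf_gt0 _))//.
by apply: g_decr; [rewrite subr_gt0|rewrite lerD2l lerN2].
Qed.

Variable delta : R.
Hypothesis delta_gt0 : 0 < delta.

Let success n (e : estimator R n) theta : \bar R :=
  product_power (shifted mu theta) n [set x | `|(e x : R) - theta| < delta].

Lemma measurable_product_shifted n (B : set (RB * n.-tuple RB)) :
  measurable B ->
  measurable_fun setT (fun theta : RB =>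
    product_power (shifted mu theta) n [set x | B (theta, x)]).
Proof.
move=> mB; pose h z := (\1_B z * likelihood z.1 z.2)%:E : \bar R.
have mh : measurable_fun setT h.
  apply/measurable_EFinP/measurable_funM; first exact: measurable_indic.
  exact: measurable_likelihood.
have h0 z : (0 <= h z)%E by rewrite lee_fin mulr_ge0// likelihood_ge0.
have := measurable_fun_fubini_tonelli_F (m2 := product_power rho n) h mh h0.
apply: eq_measurable_fun => theta _.
rewrite product_shifted_density//.
rewrite -[X in measurable X]setTI.
exact: (measurableT_comp (pair1_measurable _)).
Qed.

(** * Averaging over the parameter *)

Let weight n (J : set RB) (B : set (RB * n.-tuple RB)) z : R :=
  \1_J z.1 * \1_B z * likelihood z.1 z.2.

Let weight_ge0 n J (B : set (RB * n.-tuple RB)) z : 0 <= weight J B z.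
Proof. by rewrite !mulr_ge0// likelihood_ge0. Qed.

Let measurable_weight n J (B : set (RB * n.-tuple RB)) :
  measurable J -> measurable B -> measurable_fun setT (weight J B).
Proof.
move=> mJ mB; apply: measurable_funM; last exact: measurable_likelihood.
apply: measurable_funM; last exact: measurable_indic.
by apply: (measurableT_comp _ measurable_fst); exact: measurable_indic.
Qed.

Let measurable_integral_weight n J (B : set (RB * n.-tuple RB)) :
  measurable J -> measurable B ->
  measurable_fun setT
    (fun x => \int[lambda]_theta (weight J B (theta, x))%:E)%E.
Proof.
move=> mJ mB; pose h z := (weight J B z)%:E : \bar R.
apply: (measurable_fun_fubini_tonelli_G (m1 := lambda) h).
  by apply/measurable_EFinP; exact: measurable_weight.
by move=> z; rewrite lee_fin.
Qed.

(** Tonelli for the integrand [weight J B]: the parameter, which is integrated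
    last on the left, is integrated first on the right, at a fixed sample. *)
Let integral_product_shifted n (J : set RB) (B : set (RB * n.-tuple RB)) :
  measurable J -> measurable B ->
  (\int[lambda]_(theta in J)
     product_power (shifted mu theta) n [set x | B (theta, x)] =
   \int[product_power rho n]_x \int[lambda]_theta
     (weight J B (theta, x))%:E)%E.
Proof.
move=> mJ mB; pose h z := (weight J B z)%:E : \bar R.
have mh : measurable_fun setT h.
  by apply/measurable_EFinP; exact: measurable_weight.
have h0 z : (0 <= h z)%E by rewrite lee_fin.
rewrite -(fubini_tonelli h mh h0) integral_mkcond; apply: eq_integral => t _.
have mBt : measurable [set x | B (t, x)].
  rewrite -[X in measurable X]setTI.
  exact: (measurableT_comp (pair1_measurable _)).
rewrite epatch_indic/= product_shifted_density// muleC -ge0_integralZl_EFin//.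
- by apply: eq_integral => x _; rewrite -EFinM mulrA.
- by move=> x _; rewrite lee_fin mulr_ge0// likelihood_ge0.
- apply/measurable_EFinP/measurable_funM; first exact: measurable_indic.
  exact: (measurableT_comp (@measurable_likelihood n) (pair1_measurable t)).
Qed.

(** Pointwise in the sample this is [interval_exchange].  The error term accounts
    for the samples whose smallest observation exceeds [T]; it is the length of
    [[T - 2 * delta, T[], as each parameter there contributes at most 1. *)
Lemma average_success n (e : estimator R n.+1) (T : R) :
  (\int[lambda]_(theta in `[0%R, T[) success e theta <=
   \int[lambda]_(theta in `[0%R, T[)
     success (min_estimator delta : estimator R n.+1) theta
   + (delta *+ 2)%:E)%E.
Proof.
have mitv (i : interval R) : measurable ([set` i] : set RB).
  by exact (measurable_itv i).
(* the error term as the integral of the probability of the sure event *)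
have -> : ((delta *+ 2)%:E = \int[lambda]_(theta in `[(T - delta *+ 2)%R, T[)
    product_power (shifted mu theta) n.+1
      [set x | ([set: RB * n.+1.-tuple RB]) (theta, x)])%E.
  under eq_integral do rewrite probability_setT.
  rewrite integral_cst// mul1e; apply/esym.
  rewrite -[LHS]/(lebesgue_measure `[(T - delta *+ 2)%R, T[%classic).
  rewrite lebesgue_measure_itv/= lte_fin ltrBlDr ltrDl mulrn_wgt0//.
  by rewrite -EFinB; congr EFin; ring.
pose S (e : estimator R n.+1) : set (RB * n.+1.-tuple RB) :=
  [set z | `|(e z.2 : R) - z.1| < delta].
have mS e' : measurable (S e') by exact: measurable_success_event.
rewrite (integral_product_shifted (mitv _) (mS e)).
rewrite (integral_product_shifted (mitv _) (mS (min_estimator delta))).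
rewrite (integral_product_shifted (mitv _) measurableT).
have mG e' := measurable_integral_weight (mitv `[0, T[) (mS e').
have mGT := measurable_integral_weight (n := n.+1)
  (mitv `[T - delta *+ 2, T[) measurableT.
have G0 J B (x : n.+1.-tuple RB) :
    (0 <= \int[lambda]_theta (weight J B (theta, x))%:E)%E.
  by apply: integral_ge0 => t _; rewrite lee_fin.
rewrite -ge0_integralD//.
apply: ge0_le_integral => //.
  by apply: emeasurable_funD; first exact: mG.
move=> x _.
have mw J B : measurable J -> measurable B ->
  measurable_fun setT (fun t : RB => (weight J B (t, x))%:E : \bar R).
  move=> mJ mB; apply/measurable_EFinP.
  exact: (measurableT_comp (measurable_weight mJ mB) (pair2_measurable x)).
rewrite -ge0_integralD//; first last.
- exact: mw.
- by move=> t _; rewrite lee_fin.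
- exact: mw.
- by move=> t _; rewrite lee_fin.
have ml : measurable_fun setT (fun t : RB => likelihood t x).
  exact: (measurableT_comp (@measurable_likelihood n.+1) (pair2_measurable x)).
have := @interval_exchange R (fun t => likelihood t x) (sample_min x) T delta
  (e x) ml (fun t => likelihood_ge0 t x) (fun t => @likelihood_after_min n t x)
  (fun s t => @likelihood_nondecreasing n s t x).
move=> /le_trans; apply; rewrite le_eqVlt; apply/predU1P; left.
apply: eq_integral => t _.
by rewrite -EFinD /weight indicT/= mulr1.
Qed.

(** For a competitor of quality [q], [average_success] gives
    [T * q <= T * p + 2 * delta], and the choice [T := 2 * delta / eps] turns this
    into [q <= p + eps]. *)
Lemma min_estimator_optimal n :
  optimal mu delta (min_estimator delta : estimator R n.+1).
Proof.
pose e : estimator R n.+1 := min_estimator delta.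
move=> e'.
pose p := product_power mu n.+1 [set x | `|(e x : R)| < delta].
have successe theta : success e theta = p.
  exact/shift_invariant_quality/shift_invariant_min_estimator.
have -> : quality mu delta e = p.
  rewrite -[RHS]ereal_inf1; congr ereal_inf.
  apply/seteqP; split => [_ [theta _ <-]|_ ->]; first exact: successe.
  by exists 0 => //; exact: successe.
have q_le theta : (quality mu delta e' <= success e' theta)%E.
  by apply: ereal_inf_lbound; exists theta.
have q0 : (0 <= quality mu delta e')%E.
  by apply/ereal_infP => _ [theta _ <-].
apply/lee_addgt0Pr => eps eps0.
pose T := delta *+ 2 / eps.
have T0 : 0 < T by rewrite divr_gt0// mulrn_wgt0.
have int_cst c :
    (\int[@lebesgue_measure R]_(theta in `[0%R, T[) c = T%:E * c)%E.
  rewrite integral_cst// muleC; congr (_ * _)%E.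
  rewrite -[LHS]/(lebesgue_measure `[0%R, T[%classic).
  by rewrite lebesgue_measure_itv/= lte_fin T0 -EFinB subr0.
have : (T%:E * quality mu delta e' <= T%:E * (p + eps%:E))%E.
  rewrite ge0_muleDr ?lee_fin ?(ltW eps0) ?measure_ge0//.
  have -> : (T%:E * eps%:E = (delta *+ 2)%:E :> \bar R)%E.
    by congr EFin; rewrite divfK// gt_eqF.
  have := average_success e' T.
  rewrite -/e -/(success e').
  under [X in (_ <= X + _)%E -> _]eq_integral do
    rewrite -/(success e _) successe.
  rewrite int_cst; apply: le_trans; rewrite -int_cst.
  apply: ge0_le_integral => //.
    apply: measurable_funTS.
    exact: (measurable_product_shifted (measurable_success_event delta e')).
  by move=> theta _; exact: q_le.
by move=> h; rewrite -(@lee_pmul2l _ T%:E) ?lte_fin.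
Qed.

End likelihood.

Theorem mainTheorem4 (R : realType) (delta : R) (delta_gt0 : 0 < delta)
    (mu : probability (measurableTypeR R) R) (f : R -> R)
    (mu_f : has_density mu f)
    (f_decr : {in `[0, +oo[ &, nonincreasing_fun f})
    (f_neg0 : forall x : R, x < 0 -> f x = 0)
    (n : nat) (n_ge1 : (1 <= n)%N) :
  exists e : estimator R n, shift_invariant e /\ optimal mu delta e.
Proof.
case: n n_ge1 => // n _.
have [mf f0 muE] := mu_f.
(* changing the density at 0 does not change [mu] *)
pose g x := f x * \1_`]0, +oo[ x.
have mg : measurable_fun [set: measurableTypeR R] (g : measurableTypeR R -> R).
  by apply: measurable_funM => //; exact: measurable_indic.
have g0 x : 0 <= g x by rewrite mulr_ge0.
have gneg x : x <= 0 -> g x = 0.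
  move=> x0; rewrite /g indicE memNset ?mulr0//= in_itv/= andbT.
  by apply/negP; rewrite -leNgt.
have gpos x : 0 < x -> g x = f x.
  by move=> x0; rewrite /g indicE mem_set ?mulr1//= in_itv/= andbT.
have gdecr x y : 0 < x -> x <= y -> g y <= g x.
  move=> x0 xy; rewrite !gpos//; last exact: lt_le_trans xy.
  by apply: f_decr => //; rewrite in_itv/= andbT ltW// (lt_le_trans x0).
have muE' (A : set (measurableTypeR R)) : measurable A ->
    mu A = (\int[lebesgue_measure]_(x in A) (g x)%:E)%E.
  move=> mA; rewrite muE//.
  rewrite -(@integral_setD1 _ _ 0); last 2 first.
  - exact: measurableD.
  - by apply/measurable_EFinP; exact: measurable_funTS.
  rewrite -[RHS](@integral_setD1 _ _ 0); last 2 first.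
  - exact: measurableD.
  - by apply/measurable_EFinP; exact: measurable_funTS.
  apply: eq_integral => x; rewrite inE => -[_ /= x0].
  have [xneg|xpos|xE] := ltgtP x 0; last by case: x0.
  - by rewrite gneg ?ltW// f_neg0.
  - by rewrite gpos.
exists (min_estimator delta : estimator R n.+1); split.
  exact: shift_invariant_min_estimator.
exact: (min_estimator_optimal mg g0 muE' gneg gdecr delta_gt0).
Qed.
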